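(* Let \(G\) be a bipartite graph with fixed parts \(A\) and \(B\). Then the following statements are equivalent: (i) Either \(G\) is nonempty (i.e. \(E(G)\neq\varnothing\)), or \(G\) is empty but both \(A\) and \(B\) are infinite. (ii) \(G\) is proximinal for some metric space. (iii) \(G\) is proximinal for some semimetric space.
   Context: All graphs are simple. A bipartite graph \(G\) with fixed parts \(A\), \(B\) has vertex set \(V(G)=A\cup B\), where \(A,B\) are nonempty and disjoint, and every edge has one end in \(A\) and one in \(B\). \(G\) is empty if \(E(G)=\varnothing\). A semimetric on a set \(X\) is a function \(d\colon X\times X\to[0,\infty)\) with \(d(x,y)=d(y,x)\) and \(d(x,y)=0\iff x=y\); \((X,d)\) with \(X\neq\varnothing\) is a semimetric space. A set \(A\subseteq X\) is proximinal in \((X,d)\) if for every \(x\in X\) there is \(a_0\in A\) with \(d(x,a_0)=\inf\{d(x,a)\colon a\in A\}\) (in particular proximinal sets are nonempty). For nonempty \(A,B\subseteq X\), \(\operatorname{dist}(A,B)=\inf\{d(a,b)\colon a\in A, b\in B\}\). A bipartite graph \(G\) with fixed parts \(A\), \(B\) is proximinal for the semimetric space \((X,d)\) if \(A\) and \(B\) are disjoint proximinal subsets of \(X\) and for all \(a\in A\), \(b\in B\): \(\{a,b\}\in E(G)\iff d(a,b)=\operatorname{dist}(A,B)\). *)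

(* Defs.v *)
From HB Require Import structures.
From mathcomp Require Import all_boot all_order all_algebra.
From mathcomp Require Import all_classical all_reals all_analysis.

Set Implicit Arguments.
Unset Strict Implicit.
Unset Printing Implicit Defensive.

Import Order.TTheory GRing.Theory Num.Theory.

Local Open Scope classical_set_scope.
Local Open Scope ring_scope.

(* The type [V] is the vertex set, whence [bg_cover]. An edge is an unordered
   pair, encoded as a symmetric relation; it is irreflexive because of
   [bg_disj] and [bg_edge]. *)
Record bigraph (V : Type) := Bigraph {
  partA : set V ;
  partB : set V ;
  edge : V -> V -> Prop ;
  bg_A0 : partA !=set0 ;
  bg_B0 : partB !=set0 ;
  bg_disj : partA `&` partB = set0 ;
  bg_cover : partA `|` partB = [set: V] ;
  bg_sym : forall x y, edge x y -> edge y x ;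
  bg_edge : forall x y, edge x y ->
    (partA x /\ partB y) \/ (partB x /\ partA y) }.

Definition nonempty_graph (V : Type) (G : bigraph V) : Prop :=
  exists x y, edge G x y.

Definition empty_graph (V : Type) (G : bigraph V) : Prop :=
  ~ nonempty_graph G.

Definition semimetric (R : realType) (X : Type) (d : X -> X -> R) : Prop :=
  [/\ forall x y, 0 <= d x y,
      forall x y, d x y = d y x &
      forall x y, d x y = 0 <-> x = y].

Definition proximinal (R : realType) (X : Type) (d : X -> X -> R)
    (S : set X) : Prop :=
  forall x, exists2 s0, S s0 & d x s0 = inf [set d x s | s in S].

Definition set_dist (R : realType) (X : Type) (d : X -> X -> R)
    (S T : set X) : R :=
  inf [set d s t | s in S & t in T].

(* The inclusion of the vertex set in the space [X] is expressed by an
   injection [f : V -> X]; the parts are then the subsets [f @` partA G] and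
   [f @` partB G] of [X]. *)
Definition proximinal_for (R : realType) (V : Type) (G : bigraph V)
    (X : Type) (d : X -> X -> R) : Prop :=
  exists f : V -> X,
    let A := f @` partA G in
    let B := f @` partB G in
    [/\ injective f,
        A `&` B = set0,
        proximinal d A,
        proximinal d B &
        forall a b, partA G a -> partB G b ->
          (edge G a b <-> d (f a) (f b) = set_dist d A B)].

Definition proximinal_metric (R : realType) (V : Type) (G : bigraph V) : Prop :=
  exists X : metricType R, [set: X] !=set0 /\ proximinal_for G (@mdist R X).

Definition proximinal_semimetric (R : realType) (V : Type) (G : bigraph V) :
    Prop :=
  exists (X : Type) (d : X -> X -> R),
    [/\ [set: X] !=set0, semimetric d & proximinal_for G d].

(* Main.v *)
Require Import Defs.
From HB Require Import structures.
From mathcomp Require Import all_boot all_order all_algebra.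
From mathcomp Require Import all_classical all_reals all_analysis.
From mathcomp Require Import lra.

(** If the parts are proximinal and their distance is not attained, neither part
    is finite: over a finite part the nearest-point distances to the other part
    have a minimum, which is the distance of the parts. Conversely, any
    symmetric function with values in [[1, 2]] off the diagonal is a metric. If
    there is an edge, give edges the value [1] and all other pairs the value
    [2]. If there is none and both parts are infinite, choose [r] mapping each
    part onto [nat], and give [x, y] the value [1 + 1 / (r x + 1)] if
    [r x = r y], and [2] otherwise. *)

Set Implicit Arguments.
Unset Strict Implicit.
Unset Printing Implicit Defensive.

Import Order.TTheory GRing.Theory Num.Theory.

Local Open Scope classical_set_scope.
Local Open Scope ring_scope.

(** * Infima, finite minima and distances of sets *)

Lemma inf_attained (R : realType) (E : set R) (m : R) :
  E m -> lbound E m -> inf E = m.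
Proof.
move=> Em mlb; apply/le_anti/andP; split.
  by apply: ge_inf => //; exists m.
by apply: lb_le_inf => //; exists m.
Qed.

Lemma finite_set_min (R : realType) (E : set R) :
  finite_set E -> E !=set0 -> exists2 m, E m & lbound E m.
Proof.
move=> /finite_seqP[s ->]; elim: s => [|x s IHs] [y /=]; first by rewrite in_nil.
move=> _; case: (pselect ([set` s] !=set0)) => [/IHs[m /= ms mlb]|s0].
  have [xm|mx] := leP x m.
    exists x => [|z /=]; first by rewrite mem_head.
    by rewrite in_cons => /orP[/eqP->//|/mlb]; apply: le_trans.
  exists m => [|z /=]; first by rewrite in_cons ms orbT.
  by rewrite in_cons => /orP[/eqP->|/mlb//]; apply: ltW.
exists x => [|z /=]; first by rewrite mem_head.
by rewrite in_cons => /orP[/eqP->//|zs]; case: s0; exists z.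
Qed.

Section SetDist.
Variables (R : realType) (X : Type) (d : X -> X -> R).
Hypothesis d_semi : semimetric d.

Lemma set_distC (S T : set X) : set_dist d S T = set_dist d T S.
Proof.
have [_ dC _] := d_semi.
by congr (inf _); apply/seteqP; split=> _ [x ? [y ? <-]];
  exists y => //; exists x.
Qed.

Lemma finite_set_dist_attained (S T : set X) :
  finite_set S -> S !=set0 -> proximinal d T ->
  exists s t, [/\ S s, T t & d s t = set_dist d S T].
Proof.
move=> finS [s0 Ss0] Tprox; have [d_ge0 _ _] := d_semi.
pose phi s := inf [set d s t | t in T].
have [||_ [s Ss <-] smin] := @finite_set_min R (phi @` S).
- exact: finite_image.
- by exists (phi s0), s0.
have [t Tt dst] := Tprox s.
exists s, t; split=> //; apply/esym/inf_attained; first by exists s => //; exists t.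
move=> _ [s' Ss' [t' Tt' <-]].
(* The chain is [d s t = phi s <= phi s' <= d s' t']. *)
rewrite dst; apply: (le_trans (smin _ (ex_intro2 _ _ _ Ss' erefl))).
apply: ge_inf; last by exists t'.
by exists 0 => _ [t'' _ <-].
Qed.

End SetDist.

(** * From a proximinal representation to the condition on the parts *)

Lemma proximinal_semimetric_parts (R : realType) (V : Type) (G : bigraph V) :
  proximinal_semimetric R G ->
  nonempty_graph G \/
    (empty_graph G /\ infinite_set (partA G) /\ infinite_set (partB G)).
Proof.
case=> X [d [_ d_semi [f [_ _ proxA proxB edgeP]]]].
have [|Gempty] := pselect (nonempty_graph G); [by left | right; split=> //].
have imA0 : f @` partA G !=set0.
  by have [a Aa] := bg_A0 G; exists (f a), a.
have imB0 : f @` partB G !=set0.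
  by have [b Bb] := bg_B0 G; exists (f b), b.
(* A finite part makes the distance attained, and [edgeP] turns an attaining pair into an edge. *)
split=> fin; apply: Gempty.
- have [_ [_ [[a Aa <-] [b Bb <-] dab]]] :=
    finite_set_dist_attained d_semi (finite_image f fin) imA0 proxB.
  by exists a, b; apply/edgeP.
- have [_ [_ [[b Bb <-] [a Aa <-] dba]]] :=
    finite_set_dist_attained d_semi (finite_image f fin) imB0 proxA.
  have [_ dC _] := d_semi.
  by exists a, b; apply/edgeP => //; rewrite dC dba set_distC.
Qed.

Lemma proximinal_metric_semimetric (R : realType) (V : Type) (G : bigraph V) :
  proximinal_metric R G -> proximinal_semimetric R G.
Proof.
case=> X [X0 GX]; exists X, (@mdist R X); split=> //; split.
- exact: mdist_ge0.
- exact: metric_sym.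
- by move=> x y; split=> [/mdist_positivity //|->]; apply: mdistxx.
Qed.

Lemma bigraph_parts_neq (V : Type) (G : bigraph V) a b :
  partA G a -> partB G b -> a <> b.
Proof.
move=> Aa Bb ab; have := bg_disj G; rewrite -subset0 => /(_ a); apply.
by split=> //; rewrite ab.
Qed.

Lemma bigraph_partAB (V : Type) (G : bigraph V) x : partA G x \/ partB G x.
Proof. by have : [set: V] x by []; rewrite -(bg_cover G). Qed.

(** * Metrics from weights in [[1, 2]] *)

Section WeightMetric.
Variables (R : realType) (V : Type) (G : bigraph V) (w : V -> V -> R).
Hypothesis wC : forall x y, w x y = w y x.
Hypothesis w_ge1 : forall x y, 1 <= w x y.
Hypothesis w_le2 : forall x y, w x y <= 2.

(** Overwriting the diagonal by 0 lets [w] be given by a uniform formula that need not vanish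
    there. *)
Definition weight_dist (x y : V) : R := if `[< x = y >] then 0 else w x y.

Lemma weight_distxx x : weight_dist x x = 0.
Proof. by rewrite /weight_dist asboolT. Qed.

Lemma weight_dist_neq x y : x <> y -> weight_dist x y = w x y.
Proof. by move=> xy; rewrite /weight_dist asboolF. Qed.

Lemma weight_dist_eq0 x y : weight_dist x y = 0 -> x = y.
Proof.
rewrite /weight_dist; case: asboolP => // _ w0.
by have := w_ge1 x y; rewrite w0 ler10.
Qed.

Lemma weight_distC x y : weight_dist x y = weight_dist y x.
Proof.
have [->//|xy] := pselect (x = y).
by rewrite !weight_dist_neq // => /esym.
Qed.

Lemma weight_dist_ge0 x y : 0 <= weight_dist x y.
Proof.
by rewrite /weight_dist; case: asboolP => // _; apply: le_trans (w_ge1 x y).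
Qed.

(** For distinct points the right side is a sum of two weights, each at least 1, and the left side
    is one weight, at most 2. *)
Lemma weight_dist_triangle y x z :
  weight_dist x z <= weight_dist x y + weight_dist y z.
Proof.
have [<-|xy] := pselect (x = y); first by rewrite weight_distxx add0r.
have [<-|yz] := pselect (y = z); first by rewrite weight_distxx addr0.
have [<-|xz] := pselect (x = z).
  by rewrite weight_distxx addr_ge0 ?weight_dist_ge0.
rewrite !weight_dist_neq //.
have := w_le2 x z; have := w_ge1 x y; have := w_ge1 y z; lra.
Qed.

(** Conditions tying [w] to the graph: each vertex has a nearest vertex in the opposite part, the
    weights across the parts have infimum 1, attained or not, and edges are exactly the cross pairs
    of weight 1. *)
Hypothesis minA : forall a, partA G a ->
  exists2 b, partB G b & forall b', partB G b' -> w a b <= w a b'.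
Hypothesis minB : forall b, partB G b ->
  exists2 a, partA G a & forall a', partA G a' -> w b a <= w b a'.
Hypothesis w_inf : forall e, 0 < e ->
  exists a b, [/\ partA G a, partB G b & w a b < 1 + e].
Hypothesis w_edge : forall a b, partA G a -> partB G b ->
  (edge G a b <-> w a b = 1).

(** A point of [S] is its own nearest point, so minimizers are needed only for points of [T].
    Abstract [S] and [T] let the lemma serve both parts. *)
Lemma weight_proximinal (S T : set V) :
  (forall x, S x \/ T x) -> (forall s t, S s -> T t -> s <> t) ->
  (forall t, T t -> exists2 s, S s & forall s', S s' -> w t s <= w t s') ->
  proximinal weight_dist S.
Proof.
move=> STx ST_neq min x; case: (STx x) => [Sx|Tx].
  exists x => //; rewrite weight_distxx; apply/esym/inf_attained.
    by exists x; rewrite ?weight_distxx.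
  by move=> _ [y _ <-]; apply: weight_dist_ge0.
have neq s : S s -> x <> s by move=> Ss xs; apply: (ST_neq s x).
have [s Ss smin] := min x Tx; exists s => //.
apply/esym/inf_attained; first by exists s.
by move=> _ [s' Ss' <-]; rewrite !weight_dist_neq ?smin //; apply: neq.
Qed.

Lemma weight_set_dist : set_dist weight_dist (partA G) (partB G) = 1.
Proof.
have wd a b : partA G a -> partB G b -> weight_dist a b = w a b.
  by move=> Aa Bb; apply/weight_dist_neq/(bigraph_parts_neq Aa Bb).
have lb1 : lbound [set weight_dist a b | a in partA G & b in partB G] 1.
  by move=> _ [a Aa [b Bb <-]]; rewrite wd.
apply/le_anti/andP; split.
  apply/ler_addgt0Pr => e e0; have [a [b [Aa Bb /ltW]]] := w_inf e0.
  apply: le_trans; rewrite -wd //.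
  by apply: ge_inf; [exists 1 | exists a => //; exists b].
apply: lb_le_inf => //; have [a Aa] := bg_A0 G; have [b Bb] := bg_B0 G.
by exists (weight_dist a b), a => //; exists b.
Qed.

Lemma weight_proximinal_metric : proximinal_metric R G.
Proof.
(* The space is the vertex set itself, embedded by the identity; [{classic V}] equips it with
   equality and choice. *)
pose X : metricType R := HB.pack {classic V}
  (@isMetric.Build R {classic V} weight_dist weight_distxx weight_dist_eq0
    weight_distC weight_dist_triangle).
exists X; split; first by have [a _] := bg_A0 G; exists (a : V).
exists (id : V -> V).
change (@mdist R X) with weight_dist; rewrite /= !image_id; split=> //.
- exact: bg_disj.
- apply: (weight_proximinal _ _ minB); first exact: bigraph_partAB.
  exact: bigraph_parts_neq.
- apply: (@weight_proximinal _ (partA G)) => //.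
  + by move=> x; apply/or_comm; apply: bigraph_partAB.
  + by move=> b a Bb Aa /esym; apply: bigraph_parts_neq Aa Bb.
- move=> a b Aa Bb; rewrite weight_set_dist weight_dist_neq.
    exact: w_edge.
  exact: bigraph_parts_neq Aa Bb.
Qed.

End WeightMetric.

(** * Suitable weights for nonempty graphs and for empty graphs with infinite parts *)

Lemma nonempty_proximinal_metric (R : realType) (V : Type) (G : bigraph V) :
  nonempty_graph G -> proximinal_metric R G.
Proof.
case=> x0 [y0 xy0]; pose w x y : R := if `[< edge G x y >] then 1 else 2.
have w1 x y : edge G x y -> w x y = 1 by move=> xy; rewrite /w asboolT.
have w2 x y : ~ edge G x y -> w x y = 2 by move=> xy; rewrite /w asboolF.
have w_ge1 x y : 1 <= w x y.
  by rewrite /w; case: ifP => // _; rewrite ler1n.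
have w_le2 x y : w x y <= 2.
  by rewrite /w; case: ifP => // _; rewrite ler1n.
(* With only two values, any neighbour of [x] in [S] is nearest; without neighbours there, all
   points of [S] have weight 2 and any of them will do. *)
have wmin (S : set V) x : S !=set0 ->
    exists2 s, S s & forall s', S s' -> w x s <= w x s'.
  move=> [s0 Ss0].
  have [[s Ss xs]|noedge] := pselect (exists2 s, S s & edge G x s).
    by exists s => // s' _; rewrite (w1 _ _ xs).
  exists s0 => // s' Ss'; rewrite (w2 x s') // => xs'.
  by apply: noedge; exists s'.
apply: (@weight_proximinal_metric R V G w) => //.
- move=> x y; rewrite /w; congr (if _ then _ else _).
  by apply: asbool_equiv_eq; split; apply: bg_sym.
- by move=> a _; apply: wmin; apply: bg_B0.
- by move=> b _; apply: wmin; apply: bg_A0.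
- move=> e e0; have [[Ax By]|[Bx Ay]] := bg_edge xy0.
    by exists x0, y0; rewrite w1 // ltrDl.
  by exists y0, x0; rewrite w1 ?ltrDl //; apply: bg_sym.
- move=> a b _ _; split=> [/w1 //|wab].
  apply: contrapT => /w2; rewrite wab => /eqP.
  by rewrite eq_sym -subr_eq0 -[2]/(1 + 1) addrK oner_eq0.
Qed.

Lemma infinite_set_onto_nat (T : Type) (S : set T) :
  infinite_set S -> exists f : T -> nat, forall n, exists2 s, S s & f s = n.
Proof.
move=> /infiniteP/pcard_surjP[f fS]; exists f => n.
by have [s Ss <-] := fS n I; exists s.
Qed.

Lemma infinite_parts_proximinal_metric (R : realType) (V : Type)
    (G : bigraph V) :
  empty_graph G -> infinite_set (partA G) -> infinite_set (partB G) ->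
  proximinal_metric R G.
Proof.
move=> G0 /infinite_set_onto_nat[f fA] /infinite_set_onto_nat[g gB].
(* Disjointness of the parts lets [f] on one and [g] on the other be glued without losing
   surjectivity on either. *)
pose r x := if `[< partA G x >] then f x else g x.
have rA n : exists2 a, partA G a & r a = n.
  by have [a Aa <-] := fA n; exists a => //; rewrite /r asboolT.
have rB n : exists2 b, partB G b & r b = n.
  have [b Bb <-] := gB n; exists b => //; rewrite /r asboolF // => Ab.
  exact: (bigraph_parts_neq Ab Bb).
(* On a common level [n] the weight [1 + 1 / (n + 1)] exceeds 1 but tends to 1 as [n] grows, so the
   distance 1 is approached and never attained. The successor keeps the inverse in [(0, 1]] at level
   0 too. *)
pose w x y : R := if r x == r y then 1 + (r x).+1%:R^-1 else 2.
have w_eq x y : r y = r x -> w x y = 1 + (r x).+1%:R^-1.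
  by move=> rxy; rewrite /w rxy eqxx.
have inv_le1 n : (n.+1%:R : R)^-1 <= 1 by rewrite invf_le1 ?ltr0n ?ler1n.
have w_gt1 x y : 1 < w x y.
  by rewrite /w; case: ifP => _; rewrite ?ltr1n // ltrDl invr_gt0 ltr0n.
have wmin (S : set V) x : (forall n, exists2 s, S s & r s = n) ->
    exists2 s, S s & forall s', S s' -> w x s <= w x s'.
  (* A point of [S] on the level of [x] is nearest: other levels give 2, and the same level gives
     the same weight. *)
  move=> /(_ (r x))[s Ss rs]; exists s => // s' _.
  rewrite w_eq // /w; case: ifP => // _.
  by rewrite -[2]/(1 + 1) lerD2l.
apply: (@weight_proximinal_metric R V G w).
- by move=> x y; rewrite /w eq_sym; case: ifP => // /eqP->.
- by move=> x y; apply/ltW.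
- move=> x y; rewrite /w; case: ifP => // _.
  by rewrite -[2]/(1 + 1) lerD2l.
- by move=> a _; apply: wmin.
- by move=> b _; apply: wmin.
(* Since [n + 1] exceeds [e^-1], two vertices on level [n], one in each part, have weight below
   [1 + e]. *)
- move=> e e0; pose n := Num.truncn e^-1.
  have [[a Aa ra] [b Bb rb]] := (rA n, rB n).
  exists a, b; rewrite w_eq ?ra // ltrD2l; split=> //.
  by rewrite invf_plt ?posrE ?ltr0n // truncnS_gt.
(* Both sides are false: there are no edges, and every weight is above 1. *)
- move=> a b _ _; split=> [ab|wab]; first by case: G0; exists a, b.
  by have := w_gt1 a b; rewrite wab ltxx.
Qed.

Theorem theorem2p1 (R : realType) (V : Type) (G : bigraph V) :
  [<-> nonempty_graph G \/
         (empty_graph G /\ infinite_set (partA G) /\ infinite_set (partB G));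
       proximinal_metric R G;
       proximinal_semimetric R G].
Proof.
tfae.
- case=> [|[G0 [infA infB]]]; first exact: nonempty_proximinal_metric.
  exact: infinite_parts_proximinal_metric.
- exact: proximinal_metric_semimetric.
- exact: proximinal_semimetric_parts.
Qed.
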